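(* Let $d\ge 1$ be an integer. Then $\left\lceil\sqrt[d]{\frac{n}{\Delta_d}}\,\right\rceil-d$ is a tight lower bound for $\kappa(d,n)$; that is, for every $n$ for which a digraph of degree $d$ and order $n$ exists, $$\kappa(d,n)\ \geq\ \left\lceil\sqrt[d]{\frac{n}{\Delta_d}}\,\right\rceil-d,$$ and equality holds for at least one such $n$.
   Context: In this context ''digraph'' means a Cayley digraph $\Gamma=\mathrm{Cay}(G,T)$ of a finite Abelian group $G$ with respect to a generating set $T\subset G$ with $0\notin T$: its vertex set is $G$ and its arcs are $g\to g+t$ for $g\in G$, $t\in T$. Its order is $\mathrm{ord}(\Gamma)=|\Gamma|=|G|$, its degree is $\deg(\Gamma)=|T|$, and $k(\Gamma)$ denotes its (directed) diameter. Define $$\kappa(d,n)=\min\{k(\Gamma):\ \mathrm{ord}(\Gamma)=n,\ \deg(\Gamma)=d\}.$$ The solid density of a digraph $\Gamma$ of degree $d$ and order $n$ is $\delta(\Gamma)=\dfrac{n}{(k(\Gamma)+d)^d}$, and the global solid density for degree $d$ is $\Delta_d=\sup\{\delta(\Gamma):\ \deg(\Gamma)=d\}$ (a finite positive real number). *)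

(* Defs.v *)
From HB Require Import structures.
From mathcomp Require Import all_boot all_order all_algebra all_fingroup.
From mathcomp Require Import all_classical all_reals all_analysis.

Set Implicit Arguments.
Unset Strict Implicit.
Unset Printing Implicit Defensive.

Import Order.TTheory GRing.Theory Num.Theory.

Local Open Scope ring_scope.

(* Directed walks may repeat vertices; a shortest one has fewer than #|V| arcs,
   so the bounded minimum is the distance from x to y whenever y is reachable
   from x.  The default value #|V| only occurs for unreachable y. *)
Definition has_walk (V : finType) (e : rel V) (k : nat) (x y : V) : bool :=
  [exists p : k.-tuple V, path e x p && (last x p == y)].

Definition ddist (V : finType) (e : rel V) (x y : V) : nat :=
  \big[minn/#|V|]_(k < #|V| | has_walk e k x y) k.

Definition diameter (V : finType) (e : rel V) : nat :=
  (\max_(x : V) \max_(y : V) ddist e x y)%N.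

(* The group law that mathcomp attaches to a finZmodType is its addition, so
   <<T>> is the additive subgroup generated by T. *)
Record abelianCayley := AbelianCayley {
  cayley_group : finZmodType;
  cayley_gens : {set cayley_group};
  cayley_gens_neq0 : 0 \notin cayley_gens;
  cayley_gens_generate : <<cayley_gens>>%g = [set: cayley_group]
}.

Definition arc (Gamma : abelianCayley) : rel (cayley_group Gamma) :=
  [rel g h | [exists t in cayley_gens Gamma, h == g + t]].

Definition cayley_order (Gamma : abelianCayley) : nat := #|cayley_group Gamma|.

Definition cayley_degree (Gamma : abelianCayley) : nat := #|cayley_gens Gamma|.

Definition cayley_diam (Gamma : abelianCayley) : nat := diameter (@arc Gamma).

Definition realizable (d n : nat) : Prop :=
  exists Gamma : abelianCayley,
    cayley_order Gamma = n /\ cayley_degree Gamma = d.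

Definition diameters (d n : nat) : set nat :=
  [set k | exists Gamma : abelianCayley,
     [/\ cayley_order Gamma = n, cayley_degree Gamma = d
       & cayley_diam Gamma = k]]%classic.

(* The value 0 is a default, used only when (d, n) is not realizable. *)
Definition kappa (d n : nat) : nat :=
  if pselect (exists k, `[< diameters d n k >]) is left ex_k
  then ex_minn ex_k else 0%N.

Definition solid_density (R : realType) (Gamma : abelianCayley) : R :=
  (cayley_order Gamma)%:R /
  (cayley_diam Gamma + cayley_degree Gamma)%:R ^+ cayley_degree Gamma.

(* A digraph of degree d and diameter k has at most 'C(k + d, d) vertices, and
   one of degree d exists for every d > 0, so for such d this is the supremum
   of a nonempty bounded set of positive reals. *)
Definition global_solid_density (R : realType) (d : nat) : R :=
  sup [set x : R | exists2 Gamma : abelianCayley,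
         cayley_degree Gamma = d & x = solid_density R Gamma]%classic.

(* Main.v *)
Require Import Defs.
From HB Require Import structures.
From mathcomp Require Import all_boot all_order all_algebra all_fingroup.
From mathcomp Require Import all_classical all_reals all_analysis.
From mathcomp Require Import zify ring lra.

Set Implicit Arguments.
Unset Strict Implicit.
Unset Printing Implicit Defensive.

Import Order.TTheory GRing.Theory Num.Theory.

Local Open Scope ring_scope.

(** A Cayley digraph of degree d is a lattice N in Z^d of index n whose
translates of the simplex {y >= 0, |y|_1 <= k} cover Z^d, and its solid density
is n / K^d with K = k + d.  The lower bound is the definition of the supremum.
For tightness the supremum Delta need not be attained: it suffices to find a
digraph of order n' with k' + d <= m and n' > Delta (m - 1)^d.  Start from a
digraph of density very close to Delta and dilate N by m / K.  By Dirichlet's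
simultaneous approximation, m can be chosen, below a bound depending only on d
and Delta, so that each dilated generator is within a small constant of Z^d.
Rounding the generators gives an integer lattice with k' <= m - d exactly, since
k' is an integer, and with index at least Delta (m - 1/2)^d up to the defect of
the initial density, which can be made negligible because m is bounded. *)

(** * The l1-norm on Z^d *)

Definition l1norm (d : nat) (x : 'rV[int]_d) : int := \sum_i `|x 0 i|.

(* Instances of [mxE] in which the coefficients are syntactically in [int], as
   [lia] requires. *)
Section Entries.
Variable d : nat.
Implicit Types x y : 'rV[int]_d.

Lemma entryD x y i : (x + y) 0 i = x 0 i + y 0 i. Proof. exact: mxE. Qed.

Lemma entryN x i : (- x) 0 i = - x 0 i. Proof. exact: mxE. Qed.

Lemma entryB x y i : (x - y) 0 i = x 0 i - y 0 i.
Proof. by rewrite entryD entryN. Qed.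

Lemma entryZ (a : int) x i : (a *: x) 0 i = a * x 0 i. Proof. exact: mxE. Qed.

Lemma entry0 i : (0 : 'rV[int]_d) 0 i = 0. Proof. exact: mxE. Qed.

Lemma entry_delta i j : (delta_mx 0 i : 'rV[int]_d) 0 j = (j == i)%:Z.
Proof. by rewrite mxE eqxx; case: (j == i). Qed.

Definition entryE := (entryD, entryN, entryZ, entry_delta).

End Entries.

Section Norm1.
Variable d : nat.
Implicit Types x y : 'rV[int]_d.

Lemma l1norm_0 : l1norm (0 : 'rV[int]_d) = 0.
Proof. by rewrite /l1norm big1 // => i _; rewrite entry0 normr0. Qed.

Lemma l1norm_ge0 x : 0 <= l1norm x.
Proof. exact: sumr_ge0. Qed.

Lemma ler_l1normD x y : l1norm (x + y) <= l1norm x + l1norm y.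
Proof.
by rewrite -big_split; apply: ler_sum => i _; rewrite mxE ler_normD.
Qed.

Lemma l1normN x : l1norm (- x) = l1norm x.
Proof. by apply: eq_bigr => i _; rewrite mxE normrN. Qed.

Lemma ler_l1normB x y : l1norm (x - y) <= l1norm x + l1norm y.
Proof. by rewrite (le_trans (ler_l1normD _ _)) // l1normN. Qed.

Lemma l1normZ (a : int) x : l1norm (a *: x) = `|a| * l1norm x.
Proof. by rewrite mulr_sumr; apply: eq_bigr => i _; rewrite mxE normrM. Qed.

Lemma l1norm_delta i : l1norm (delta_mx 0 i : 'rV[int]_d) = 1.
Proof.
rewrite /l1norm (bigD1 i) //= mxE !eqxx big1 => [|j ji]; first by rewrite addr0.
by rewrite mxE (negPf ji) andbF.
Qed.

Lemma l1norm_le (b : int) x : (forall i, `|x 0 i| <= b) -> l1norm x <= d%:Z * b.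
Proof.
move=> xb; apply: (@le_trans _ _ (\sum_(i < d) b)); first exact: ler_sum.
by rewrite sumr_const card_ord -mulr_natl natz.
Qed.

Lemma l1norm_eq0 x : l1norm x <= 0 -> x = 0.
Proof.
move=> x0; apply/rowP => i; rewrite mxE; apply: normr0_eq0.
have : l1norm x == 0 by rewrite eq_le x0 l1norm_ge0.
by rewrite psumr_eq0 // => /allP /(_ i (mem_index_enum _)) /eqP.
Qed.

Lemma ler_l1norm_mulmx_entry (A : 'M[int]_d) (b : int) x j :
  (forall i, `|A i j| <= b) -> `|(x *m A) 0 j| <= l1norm x * b.
Proof.
move=> Ab; rewrite mxE mulr_suml (le_trans (ler_norm_sum _ _ _)) //.
by apply: ler_sum => i _; rewrite normrM ler_wpM2l.
Qed.

Lemma ler_l1norm_mulmx (A : 'M[int]_d) (b : int) x :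
  (forall i, l1norm (row i A) <= b) -> l1norm (x *m A) <= l1norm x * b.
Proof.
move=> Ab; rewrite mulmx_sum_row.
elim/big_rec2: (l1norm x) => [|i y1 y2 _ IH].
  by rewrite mul0r l1norm_0.
rewrite (le_trans (ler_l1normD _ _)) // mulrDl lerD // l1normZ.
by rewrite ler_wpM2l.
Qed.

Lemma ler_l1norm_sub_delta (a : int) x i :
  0 < a -> a <= `|x 0 i| ->
  l1norm (x - (a * Num.sg (x 0 i)) *: delta_mx 0 i) <= l1norm x - a.
Proof.
move=> a0 ax; rewrite /l1norm (bigD1 i) //= [leRHS](_ : _ = 
   (`|x 0 i| - a) + \sum_(j < d | j != i) `|x 0 j|); last first.
  by rewrite (bigD1 i) //= addrAC.
apply: lerD; last by apply: ler_sum => j ji; rewrite !entryE (negPf ji) mulr0 subr0.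
rewrite !entryE eqxx.
by case: (sgrP (x 0 i)) ax => x0 ax; rewrite ?mulr0 ?mulr1 ?mulrN1; lia.
Qed.

End Norm1.

(** * Subgroups of Z^d, counting in boxes and simultaneous approximation *)

Definition mod_sub (d : nat) (M : 'rV[int]_d -> Prop) :=
  M 0 /\ forall x y, M x -> M y -> M (x - y).

Section Lattice.
Variable d : nat.
Implicit Types (x y : 'rV[int]_d) (M : 'rV[int]_d -> Prop).

Lemma mod_subN M x : mod_sub M -> M x -> M (- x).
Proof. by move=> [M0 MB] Mx; rewrite -sub0r; apply: MB. Qed.

Lemma mod_subD M x y : mod_sub M -> M x -> M y -> M (x + y).
Proof.
by move=> hM Mx My; rewrite -[y]opprK; apply: hM.2 => //; apply: mod_subN.
Qed.

(* Subtracting [v i] with the sign of a large coordinate decreases the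
   l1-norm. *)
Lemma lattice_reduction M (v : 'I_d -> 'rV[int]_d) (a : int) x :
  0 < a -> mod_sub M -> (forall i, M (v i)) ->
  (forall i, l1norm (v i - a *: delta_mx 0 i) < a) ->
  exists y, M (x - y) /\ forall i, `|y 0 i| < a.
Proof.
move=> a0 hM Mv va; have [n] := ubnP (absz (l1norm x)).
elim: n x => // n IH x xn.
have [/forallP xa|] := boolP [forall i, `|x 0 i| < a].
  by exists x; split=> //; rewrite subrr; exact: hM.1.
rewrite negb_forall => /existsP[i]; rewrite -leNgt => ax.
pose e := Num.sg (x 0 i).
have Mev : M (e *: v i).
  rewrite /e; case: (sgrP (x 0 i)) => _; rewrite ?scale0r ?scale1r ?scaleN1r //.
    exact: hM.1.
  exact: mod_subN.
have xlt : l1norm (x - e *: v i) < l1norm x.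
  have -> : x - e *: v i = (x - (a * e) *: delta_mx 0 i)
      - e *: (v i - a *: delta_mx 0 i).
    by rewrite scalerBr scalerA [e * a]mulrC opprB addrA subrK.
  rewrite (le_lt_trans (ler_l1normB _ _)) // l1normZ.
  have := ler_l1norm_sub_delta a0 ax; have := va i; rewrite -/e.
  have : 0 <= l1norm (v i - a *: delta_mx 0 i) by exact: l1norm_ge0.
  by rewrite /e; case: (sgrP (x 0 i)) => _; lia.
have [|y [My ya]] := IH (x - e *: v i).
  by have := l1norm_ge0 (x - e *: v i); lia.
exists y; split=> //; rewrite -(subrK (e *: v i) x) addrAC.
exact: mod_subD.
Qed.

(** The second component lies in a box of [s ^ d] integer points, so the pair embeds [X] in a finite
    product. This count replaces comparisons of volumes throughout: packing, index and order. *)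
Lemma card_le_box (X Y : finType) (f : X -> Y) (h : X -> 'rV[int]_d) (a : int)
    (s : nat) :
  injective (fun u => (f u, h u)) ->
  (forall u i, a <= h u 0 i < a + s%:Z) -> (#|X| <= #|Y| * s ^ d)%N.
Proof.
move=> inj hb.
have bnd u (i : 'I_d) : (absz (h u 0%R i - a)%R < s)%N by have := hb u i; lia.
pose F u : Y * {ffun 'I_d -> 'I_s} := (f u, [ffun i => Ordinal (bnd u i)]).
have /leq_card : injective F.
  move=> u1 u2 [fE /ffunP hE]; apply: inj; congr pair => //.
  apply/rowP => i; have := congr1 val (hE i); rewrite !ffunE /=.
  by have := hb u1 i; have := hb u2 i; lia.
by rewrite card_prod card_ffun !card_ord.
Qed.

End Lattice.

(** Dirichlet's pigeonhole argument: the vectors of fractional parts of [j m0 a_i / b], for [j] from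
    0 to [s ^ #|I|], fall into [s ^ #|I|] cubes of side [1 / s], and two in the same cube are
    subtracted. Using multiples of [m0] forces [m0 <= m]. *)
Lemma simultaneous_approximation (I : finType) (a : I -> int) (b : int)
    (s m0 : nat) : 0 < b -> (0 < s)%N -> (0 < m0)%N ->
  exists (m : nat) (w : I -> int), [/\ (m0 <= m)%N, (m <= m0 * s ^ #|I|)%N
    & forall i, s%:Z * `|m%:Z * a i - b * w i| < b].
Proof.
move=> b0 s0 m00; pose r (j : nat) i := (((j * m0)%N%:Z * a i) %% b)%Z.
pose w (j : nat) i := (((j * m0)%N%:Z * a i) %/ b)%Z.
have wr j i : (j * m0)%N%:Z * a i = w j i * b + r j i by exact: divz_eq.
have r0 j i : 0 <= r j i by rewrite modz_ge0 // gt_eqF.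
have rb j i : r j i < b by rewrite ltz_pmod.
(* [t j i] is the index of the interval of length [b / s] that contains the remainder [r j i]. *)
pose t (j : nat) i := ((s%:Z * r j i) %/ b)%Z.
pose t' (j : nat) i := ((s%:Z * r j i) %% b)%Z.
have trb j i : s%:Z * r j i = t j i * b + t' j i by exact: divz_eq.
have t'0 j i : 0 <= t' j i by rewrite modz_ge0 // gt_eqF.
have t'b j i : t' j i < b by rewrite ltz_pmod.
have t0 j i : 0 <= t j i.
  by have := trb j i; have := t'b j i; have := r0 j i; nia.
have ts j i : (absz (t j i) < s)%N.
  have : t j i < s%:Z by have := trb j i; have := t'0 j i; have := rb j i; nia.
  by have := t0 j i; lia.
pose F (j : 'I_(s ^ #|I|).+1) : {ffun I -> 'I_s} := [ffun i => Ordinal (ts j i)].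
have /injectivePn[j1 [j2 j12 /ffunP FE]] : ~~ injectiveb F.
  by apply/injectiveP => /leq_card; rewrite card_ffun !card_ord ltnn.
wlog lt12 : j1 j2 j12 FE / (j1 < j2)%N => [hwlog|].
  have [lt12|lt21|/val_inj eq12] := ltngtP j1 j2.
  - exact: (hwlog j1 j2).
  - by apply: (hwlog j2 j1) => //; rewrite eq_sym.
  - by rewrite eq12 eqxx in j12.
exists ((j2 - j1) * m0)%N, (fun i => w j2 i - w j1 i); split.
- by rewrite leq_pmull // subn_gt0.
- rewrite mulnC leq_mul2l; apply/orP; right.
  by rewrite (leq_trans (leq_subr _ _)) // -ltnS.
move=> i; have tE : t j1 i = t j2 i.
  by have /(congr1 (Posz \o val)) := FE i; rewrite !ffunE /= !gez0_abs.
have -> : ((j2 - j1) * m0)%N%:Z * a i - b * (w j2 i - w j1 i) = r j2 i - r j1 i.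
  rewrite mulnBl -subzn ?leq_mul2r ?(ltnW lt12) ?orbT //.
  by rewrite mulrBl !wr; ring.
rewrite -[s%:Z]ger0_norm // -normrM mulrBr !trb tE.
have := t'0 j1 i; have := t'b j1 i; have := t'0 j2 i; have := t'b j2 i.
by lia.
Qed.

(** * The lattice of a digraph: packing, a nearly diagonal frame and its index *)

Section KernelLattice.
Variables (d : nat) (G : finZmodType) (psi : {additive 'rV[int]_d -> G}).
Variables (k : nat) (f : G -> 'rV[int]_d).
Hypothesis d_gt0 : (0 < d)%N.
Hypothesis f_ge0 : forall g i, 0 <= f g 0 i.
Hypothesis f_norm : forall g, l1norm (f g) <= k%:Z.
Hypothesis psi_f : cancel f psi.

Local Notation K := (k + d)%N.

Lemma section_entry_le g i : f g 0 i <= k%:Z.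
Proof.
rewrite (le_trans _ (f_norm g)) // /l1norm (bigD1 i) //= ger0_norm //.
by rewrite lerDl sumr_ge0.
Qed.

Lemma kernel_sub_section x : psi (x - f (psi x)) = 0.
Proof. by rewrite raddfB psi_f subrr. Qed.

(* The translates of the transversal [range f] by lattice points are pairwise
   disjoint, which bounds the number of lattice points in a box. *)
Lemma kernel_packing (Q : nat) (h : 'I_Q.+1 -> 'rV[int]_d) :
  (forall j, psi (h j) = 0) ->
  (forall j i, `|h j 0 i| < (2 * K)%N%:Z) ->
  ((5 * K) ^ d < Q.+1 * #|G|)%N -> exists i j : 'I_Q.+1, (i < j)%N /\ h i = h j.
Proof.
move=> hK hb hQ.
have [/injectiveP inj|/injectivePn[i [j ij hij]]] := boolP (injectiveb h);
  last first.
  have [lt|gt|/val_inj eq] := ltngtP i j; first by exists i, j.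
    by exists j, i.
  by rewrite eq eqxx in ij.
have : (#|{: 'I_Q.+1 * G}| <= #|{: unit}| * (5 * K) ^ d)%N.
  (* Entries of [h] lie strictly between [-2K] and [2K], those of [f] between 0 and [k], so the sums
     lie in a box of side [5K]. *)
  apply: (@card_le_box d _ _ (fun=> tt) (fun u => h u.1 + f u.2) (- (2 * K)%N%:Z)).
    move=> [i g] [j g'] /= [] e.
    have gg : g = g'.
      by move: (congr1 psi e); rewrite !raddfD !hK !add0r !psi_f.
    by move: e; rewrite gg => /addIr /inj ->.
  move=> [j g] i /=; rewrite entryD.
  have := hb j i; have := f_ge0 g i; have := section_entry_le g i.
  by lia.
by rewrite card_prod card_ord card_unit mul1n leqNgt hQ.
Qed.

(** Subtracting from [2K e_i] the representative of its class leaves a lattice vector within [k] of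
    [2K e_i]. The rows span a sublattice of full rank and replace a basis, with explicit size
    bounds. *)
Definition kernel_frame : 'M[int]_d :=
  \matrix_i ((2 * K)%N%:Z *: delta_mx 0 i
             - f (psi ((2 * K)%N%:Z *: delta_mx 0 i))).

Local Notation u := kernel_frame.

Lemma kernel_frame_in i : psi (row i u) = 0.
Proof. by rewrite rowK kernel_sub_section. Qed.

Lemma kernel_frame_near i :
  l1norm (row i u - (2 * K)%N%:Z *: delta_mx 0 i) <= k%:Z.
Proof. by rewrite rowK addrAC subrr sub0r l1normN f_norm. Qed.

Lemma kernel_frame_norm i : l1norm (row i u) <= (3 * K)%N%:Z.
Proof.
rewrite -(subrK ((2 * K)%N%:Z *: delta_mx 0 i) (row i u)).
rewrite (le_trans (ler_l1normD _ _)) //.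
rewrite (le_trans (lerD (kernel_frame_near i) (lexx _))) //.
by rewrite l1normZ l1norm_delta mulr1; lia.
Qed.

(* The frame is diagonally dominant, hence has a bounded inverse. *)
Lemma kernel_frame_expand c : K%:Z * l1norm c <= l1norm (c *m u).
Proof.
pose S : 'M[int]_d := u - (2 * K)%N%:Z%:M.
have rowS i : row i S = row i u - (2 * K)%N%:Z *: delta_mx 0 i.
  by rewrite /S linearB /= -scalemx1 linearZ /= row1.
have Sk : l1norm (c *m S) <= l1norm c * k%:Z.
  by apply: ler_l1norm_mulmx => i; rewrite rowS kernel_frame_near.
have : l1norm ((2 * K)%N%:Z *: c) <= l1norm (c *m u) + l1norm (c *m S).
  rewrite (le_trans _ (ler_l1normB _ _)) // -mulmxBr /S opprB addrC subrK.
  by rewrite mul_mx_scalar.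
rewrite l1normZ => le2.
have : 0 <= d%:Z * l1norm c by rewrite mulr_ge0 // l1norm_ge0.
by move: le2 Sk; rewrite ger0_norm // PoszM PoszD; lia.
Qed.

(** Reduced modulo the frame, the multiples [j l] with [0 <= j <= Q] land in the packing box, so two
    reduced vectors coincide and some positive multiple of [l], by at most [Q], is in the span of
    the frame. The factorial is a common denominator for all [l]. *)
Lemma kernel_frame_index (Q : nat) l :
  ((5 * K) ^ d < Q.+1 * #|G|)%N -> psi l = 0 ->
  exists c, Q`!%:Z *: l = c *m u.
Proof.
move=> hQ lK; pose M (x : 'rV[int]_d) := exists c, x = c *m u.
have hM : mod_sub M.
  split=> [|x y [c ->] [c' ->]]; first by exists 0; rewrite mul0mx.
  by exists (c - c'); rewrite mulmxBl.
have MK x : M x -> psi x = 0.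
  move=> [c ->]; rewrite mulmx_sum_row raddf_sum big1 // => i _.
  by rewrite -[c 0 i]intz scaler_int raddfMz kernel_frame_in mul0rz.
have red (j : nat) : exists y, M (j%:Z *: l - y)
    /\ forall i, `|y 0 i| < (2 * K)%N%:Z.
  apply: (@lattice_reduction _ M (fun i => row i u)) => //.
  - by lia.
  - by move=> i; exists (delta_mx 0 i); rewrite rowE.
  - by move=> i; rewrite (le_lt_trans (kernel_frame_near i)) //; lia.
pose h (j : 'I_Q.+1) := projT1 (cid (red j)).
have hP (j : 'I_Q.+1) : M (j%:Z *: l - h j)
    /\ forall i, `|h j 0 i| < (2 * K)%N%:Z by exact: projT2 (cid (red j)).
have hK j : psi (h j) = 0.
  rewrite -(subKr (j%:Z *: l) (h j)) raddfB (MK _ (hP j).1) subr0.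
  by rewrite -[j%:Z]intz scaler_int raddfMz lK mul0rz.
have [|i [j [ij hij]]] := kernel_packing hK _ hQ; first by move=> j; exact: (hP j).2.
have : M ((j - i)%N%:Z *: l).
  rewrite -subzn ?(ltnW ij) // scalerBl.
  have -> : j%:Z *: l - i%:Z *: l = (j%:Z *: l - h j) - (i%:Z *: l - h i).
    by rewrite hij opprB addrA subrK.
  by apply: hM.2; exact: (hP _).1.
move=> [c lc].
have /dvdnP[q ->] : ((j - i)%N %| Q`!)%N.
  by rewrite dvdn_fact // subn_gt0 ij /= (leq_trans (leq_subr _ _)) // -ltnS.
exists (q%:Z *: c); rewrite PoszM -scalerA lc.
by rewrite -scalemxAl.
Qed.

End KernelLattice.

(** * Rounding a dilation of the lattice *)

(* [L] is the graph of an additive map from the kernel of [psi] to Z^d that is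
   close to the homothety of ratio [m / K]. *)
Record near_dilation (d : nat) (G : finZmodType)
    (psi : {additive 'rV[int]_d -> G}) (K m S : nat)
    (L : 'rV[int]_d -> 'rV[int]_d -> Prop) : Prop := NearDilation {
  nd_0 : L 0 0;
  nd_sub : forall l p l' p', L l p -> L l' p' -> L (l - l') (p - p');
  nd_kernel : forall l p, L l p -> psi l = 0;
  nd_total : forall l, psi l = 0 -> exists p, L l p;
  nd_error : forall l p, L l p ->
    forall j, S%:Z * `|K%:Z * p 0 j - m%:Z * l 0 j| <= l1norm l
}.

(** With [q] the factorial of [Q], round [m / (q K)] times the frame [u] to an integer matrix [W].
    If [q l = c u], then [l] is sent to [c W], which is near [(m / K) l]; the image is integral
    although [c] only expresses [q l]. The error is controlled because [kernel_frame_expand] bounds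
    [c]. *)
Lemma exists_near_dilation (d : nat) (G : finZmodType)
    (psi : {additive 'rV[int]_d -> G}) (k : nat) (f : G -> 'rV[int]_d)
    (Q m0 S : nat) :
  (0 < d)%N -> (forall g i, 0 <= f g 0 i) -> (forall g, l1norm (f g) <= k%:Z) ->
  cancel f psi -> ((5 * (k + d)) ^ d < Q.+1 * #|G|)%N ->
  (0 < S)%N -> (0 < m0)%N ->
  exists (m : nat) L, [/\ (m0 <= m)%N, (m <= m0 * (Q`! * S) ^ (d * d))%N
    & near_dilation psi (k + d) m S L].
Proof.
move=> d0 f0 fk fK hQ S0 m00; set K := (k + d)%N; set q := Q`!.
have q0 : (0 < q)%N by exact: fact_gt0.
have qK0 : 0 < (q * K)%N%:Z by rewrite ltz_nat muln_gt0 q0 addn_gt0 d0 orbT.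
pose u := kernel_frame psi k f.
(* The factor [q] in the precision [q * S] cancels the one in the modulus [q * K], so the entries of
   [m u - q K W] stay below [K / S]. *)
have [|m [w [m0m ms hw]]] := @simultaneous_approximation
    ('I_d * 'I_d)%type (fun ij => u ij.1 ij.2) _ (q * S) m0 qK0 _ m00.
  by rewrite muln_gt0 q0.
rewrite card_prod card_ord in ms.
pose W : 'M[int]_d := \matrix_(i, j) w (i, j).
pose L l p := psi l = 0 /\ exists c, q%:Z *: l = c *m u /\ p = c *m W.
exists m, L; split=> //; split.
- by split; [rewrite raddf0 | exists 0; rewrite !mul0mx scaler0].
- move=> l p l' p' [lK [c [lc ->]]] [l'K [c' [lc' ->]]]; split.
    by rewrite raddfB lK l'K subrr.
  by exists (c - c'); rewrite !mulmxBl scalerBr lc lc'.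
- by move=> l p [].
- move=> l lK; have [c lc] := kernel_frame_index d0 f0 fk fK hQ lK.
  by exists (c *m W); split=> //; exists c.
move=> l p [lK [c [lc ->]]] j.
pose E : 'M[int]_d := \matrix_(i, j)
  ((q * S)%N%:Z * (m%:Z * u i j - (q * K)%N%:Z * w (i, j))).
have Eb i : `|E i j| <= (q * K)%N%:Z.
  by rewrite mxE normrM ger0_norm // ltW // (hw (i, j)).
have := ler_l1norm_mulmx_entry c Eb.
have -> : (c *m E) 0 j = (q * S)%N%:Z *
    (q%:Z * (m%:Z * l 0 j - K%:Z * (c *m W) 0 j)).
  have lcj : q%:Z * l 0 j = \sum_i c 0 i * u i j.
    by rewrite -entryZ lc mxE.
  have cWj : (c *m W) 0 j = \sum_i c 0 i * w (i, j).
    by rewrite mxE; apply: eq_bigr => i _; rewrite mxE.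
  rewrite mulrBr mulrCA lcj mulrA -PoszM cWj !mulr_sumr -sumrB mulr_sumr mxE.
  by apply: eq_bigr => i _; rewrite mxE; ring.
have := kernel_frame_expand psi d0 fk c.
rewrite -/K -/u -lc l1normZ !normrM ![`|Posz _|]ger0_norm // !PoszM distrC.
move: (l1norm c) (l1norm l) `|_ - _| => nc nl e Kc Eq.
have q0' : 0 < q%:Z by [].
have : q%:Z * q%:Z * (S%:Z * e) <= q%:Z * q%:Z * nl.
  rewrite [leLHS](_ : _ = q%:Z * S%:Z * (q%:Z * e)); last by ring.
  rewrite (le_trans Eq) // [leLHS](_ : _ = q%:Z * (K%:Z * nc)); last by ring.
  by rewrite -mulrA ler_pM2l.
by rewrite ler_pM2l // mulr_gt0.
Qed.

(** * The dilated lattice: covering, short vectors and index *)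

Definition simplex_covers (d : nat) (M : 'rV[int]_d -> Prop) (k : nat) :=
  forall x, exists y : 'rV[int]_d, [/\ forall i, 0 <= y 0 i, l1norm y <= k%:Z & M (x - y)].

Section Dilation.
Variables (d : nat) (G : finZmodType) (psi : {additive 'rV[int]_d -> G}).
Variables (k : nat) (f : G -> 'rV[int]_d).
Hypothesis d_gt0 : (0 < d)%N.
Hypothesis f_ge0 : forall g i, 0 <= f g 0 i.
Hypothesis f_norm : forall g, l1norm (f g) <= k%:Z.
Hypothesis psi_f : cancel f psi.
Variables (m : nat) (L : 'rV[int]_d -> 'rV[int]_d -> Prop).
Hypothesis m_gt0 : (0 < m)%N.

Local Notation K := (k + d)%N.

Hypothesis Ldil : near_dilation psi K m (40 * (d * d))%N L.

Definition dilated p := exists l, L l p.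

Lemma dilated_mod_sub : mod_sub dilated.
Proof.
split=> [|p p' [l lp] [l' lp']]; first by exists 0; exact: nd_0 Ldil.
by exists (l - l'); exact: nd_sub Ldil _ _ _ _ lp lp'.
Qed.

(** Summed over the coordinates, the rounding errors amount to at most [l1norm l / (40 d)] and are
    absorbed in the left-hand side. *)
Lemma near_dilation_norm l p (b : int) : L l p -> (forall i, `|p 0 i| <= b) ->
  m%:Z * l1norm l <= 2 * K%:Z * d%:Z * b.
Proof.
move=> lp pb; have n0 := l1norm_ge0 l.
have : l1norm ((40 * (d * d) * m)%N%:Z *: l)
    <= d%:Z * ((40 * (d * d))%N%:Z * (K%:Z * b) + l1norm l).
  apply: l1norm_le => i; rewrite entryZ normrM ger0_norm // PoszM.
  have := nd_error Ldil lp i; have := pb i.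
  have : (m%:Z * `|l 0 i| <= K%:Z * `|p 0 i| + `|K%:Z * p 0 i - m%:Z * l 0 i|).
    have <- : `|m%:Z * l 0 i| = m%:Z * `|l 0 i| by rewrite normrM ger0_norm.
    have <- : `|K%:Z * p 0 i| = K%:Z * `|p 0 i| by rewrite normrM ger0_norm.
    by lia.
  move: (`|l 0 i|) (`|p 0 i|) `|_ - _| => a1 a2 e h1 h2 h3.
  rewrite -mulrA (le_trans (ler_wpM2l _ h1)) // mulrDr lerD //.
  by rewrite !ler_wpM2l.
rewrite l1normZ ger0_norm // !PoszM.
move: (l1norm l) n0 => N n0; have d1 : 1 <= d%:Z by lia.
have m1 : 1 <= m%:Z by lia.
have dm1 : 1 <= d%:Z * m%:Z by nia.
have dm : d%:Z * N <= 20%:Z * d%:Z ^+ 2 * m%:Z * N.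
  by rewrite ler_wpM2r // expr2; nia.
rewrite PoszD => h; rewrite -(@ler_pM2l _ (20%:Z * d%:Z ^+ 2)); last by nia.
move: h dm; set Kb := (_ + _) * b.
by rewrite expr2; lia.
Qed.

Lemma near_dilation_entry l p (b : int) i : L l p -> (forall i, `|p 0 i| <= b) ->
  20%:Z * d%:Z * m%:Z * `|K%:Z * p 0 i - m%:Z * l 0 i| <= K%:Z * b.
Proof.
move=> lp pb; have := near_dilation_norm lp pb; have := nd_error Ldil lp i.
rewrite !PoszM.
move: (l1norm l) `|_ - _| => N e h1 h2.
have d1 : 0 < 2%:Z * d%:Z by lia.
rewrite -(@ler_pM2l _ (2%:Z * d%:Z)) //.
rewrite [leLHS](_ : _ = m%:Z * (40%:Z * d%:Z ^+ 2 * e)); last by ring.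
rewrite (le_trans (ler_wpM2l _ h1)) // (le_trans h2) //.
by rewrite [leLHS](_ : _ = 2%:Z * d%:Z * (K%:Z * b)) //; ring.
Qed.

(** The image of the frame vector near [2K e_i] deviates from [2m e_i] by at most [m k / K] plus a
    rounding error, which is less than [2m] in total, so [lattice_reduction] applies. *)
Lemma dilated_reduction x :
  exists y, dilated (x - y) /\ forall i, `|y 0 i| < (2 * m)%N%:Z.
Proof.
pose u := kernel_frame psi k f.
have upi i : exists p, L (row i u) p.
  by apply: (nd_total Ldil); exact: kernel_frame_in.
pose v i := projT1 (cid (upi i)).
have vP i : L (row i u) (v i) := projT2 (cid (upi i)).
apply: (@lattice_reduction _ dilated v) => //; first by lia.
- exact: dilated_mod_sub.
- by move=> i; exists (row i u).
move=> i; pose e := K%:Z *: v i - m%:Z *: row i u.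
have e_small : l1norm ((40 * (d * d))%N%:Z *: e) <= d%:Z * (3 * K)%N%:Z.
  apply: l1norm_le => j; rewrite entryZ normrM ger0_norm // entryB !entryZ.
  rewrite (le_trans (nd_error Ldil (vP i) j)) //.
  exact: kernel_frame_norm.
have : l1norm (K%:Z *: (v i - (2 * m)%N%:Z *: delta_mx 0 i))
    <= l1norm e + m%:Z * k%:Z.
  rewrite (_ : _ *: _ =
    e + m%:Z *: (row i u - (2 * K)%N%:Z *: delta_mx 0 i)); last first.
    rewrite /e !scalerBr !scalerA addrA subrK.
    by congr (_ - _ *: _); rewrite -!PoszM; congr Posz; lia.
  rewrite (le_trans (ler_l1normD _ _)) // lerD2l l1normZ ger0_norm //.
  by rewrite ler_wpM2l // kernel_frame_near.
move: e_small; rewrite !l1normZ ![`|Posz _|]ger0_norm //.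
rewrite !PoszM !PoszD; have := l1norm_ge0 e.
move: (l1norm e) (l1norm (v i - _)) => N N' N0 h1 h2.
have d1 : 1 <= d%:Z by lia.
have m1 : 1 <= m%:Z by lia.
have k0 : 0 <= k%:Z by [].
have kK : k%:Z < k%:Z + d%:Z by lia.
move: (k%:Z + d%:Z) kK h1 h2 => K' kK h1 h2.
have NK : N < K'.
  have dK : d%:Z * (3 * K') < d%:Z * (40 * d%:Z * K') by rewrite ltr_pM2l; nia.
  have dd : 0 < 40%:Z * (d%:Z * d%:Z) by nia.
  by rewrite -(@ltr_pM2l _ _ dd); lia.
have : K' * N' < K' * (2%:Z * m%:Z) by nia.
by rewrite ltr_pM2l //; lia.
Qed.

(** Pull [x] back to an integer point [X] near [(K / m) x], write [X = l + y] with [l] in the kernel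
    and [y] in the simplex, and subtract from [x] the image [p] of [l]. Then [z = x - p] is near
    [(x - (m / K) X) + (m / K) y], whose coordinates exceed -1 and whose sum is less than
    [m - d + 1]. Rounding errors of at most [1 / (8 d)] per coordinate preserve this, and
    integrality of [z] concludes. *)
Lemma dilated_cover_bounded (x : 'rV[int]_d) : (forall i, `|x 0 i| < (2 * m)%N%:Z) ->
  exists z : 'rV[int]_d,
    [/\ forall i, 0 <= z 0 i, l1norm z + d%:Z <= m%:Z & dilated (x - z)].
Proof.
move=> xb.
have d1 : 0 < d%:Z by []. have m1 : 0 < m%:Z by [].
have K1 : 0 < K%:Z by rewrite ltz_nat addn_gt0 d_gt0 orbT.
(* [X] is [(K / m) x] shifted so that each coordinate of [x - (m / K) X] lies
   in [-1 + 1 / (4 d), -1 + 1 / (4 d) + m / K[, which leaves room for the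
   rounding error. *)
pose D : int := 4%:Z * d%:Z * m%:Z.
have D0 : 0 < D by rewrite /D; nia.
pose N i := 4%:Z * d%:Z * (K%:Z * (x 0 i + 1)) - K%:Z.
pose X : 'rV[int]_d := \row_i (N i %/ D)%Z.
pose r i := (N i %% D)%Z.
have XE i : N i = X 0 i * D + r i by rewrite mxE; exact: divz_eq.
have r0 i : 0 <= r i by rewrite modz_ge0 // gt_eqF.
have rD i : r i < D by rewrite ltz_pmod.
have Xb i : `|X 0 i| <= 2%:Z * K%:Z.
  have := XE i; have := r0 i; have := rD i; have := xb i; rewrite /N => xi.
  have xi1 : 4%:Z * d%:Z * (K%:Z * (x 0 i + 1)) <= 2%:Z * K%:Z * D.
    rewrite [leRHS](_ : _ = 4%:Z * d%:Z * (K%:Z * (2%:Z * m%:Z))); last first.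
      by rewrite /D; ring.
    by rewrite !ler_pM2l //; lia.
  have xi2 : K%:Z - 2%:Z * K%:Z * D <= 4%:Z * d%:Z * (K%:Z * (x 0 i + 1)).
    rewrite [leLHS](_ : _ = K%:Z + 4%:Z * d%:Z * (K%:Z * (- 2%:Z * m%:Z))).
      have : 4%:Z * d%:Z * (K%:Z * 2%:Z) + 4%:Z * d%:Z * (K%:Z * (- 2%:Z * m%:Z))
          <= 4%:Z * d%:Z * (K%:Z * (x 0 i + 1)).
        by rewrite -!mulrDr !ler_pM2l //; lia.
      have : K%:Z <= 4%:Z * d%:Z * (K%:Z * 2%:Z) by nia.
      by lia.
    by rewrite /D; ring.
  move: (4%:Z * d%:Z * _) xi1 xi2 D0 => P xi1 xi2 D0 h1 h2 h3.
  have : (X 0 i - 2%:Z * K%:Z) * D <= 0 by lia.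
  have : 0 < (X 0 i + 2%:Z * K%:Z + 1) * D by lia.
  by rewrite pmulr_lgt0 // pmulr_lle0 //; lia.
pose y := f (psi X); pose l := X - y.
have [p lp] := nd_total Ldil (kernel_sub_section psi_f X).
have ln : l1norm l <= 3%:Z * d%:Z * K%:Z.
  have := l1norm_le Xb; have := f_norm (psi X).
  have := ler_l1normB X y; rewrite -/y -/l => h1 h2 h3.
  have : K%:Z <= d%:Z * K%:Z by nia.
  by lia.
pose e i := K%:Z * p 0 i - m%:Z * l 0 i.
have eb i : 8%:Z * d%:Z * `|e i| <= K%:Z.
  have := le_trans (nd_error Ldil lp i) ln; rewrite -/(e i) !PoszM.
  have : 0 <= d%:Z * d%:Z * `|e i| by rewrite !mulr_ge0.
  move: `|e i| => E E0 h.
  rewrite -(@ler_pM2l _ (3%:Z * d%:Z)); last by lia.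
  by lia.
pose z := x - p.
have zE i : 4%:Z * d%:Z * (K%:Z * z 0 i) =
    r i - 4%:Z * d%:Z * K%:Z + K%:Z + D * y 0 i - 4%:Z * d%:Z * e i.
  have := XE i; rewrite /N /e /z /l !entryB => h.
  have -> : r i = 4%:Z * d%:Z * (K%:Z * (x 0 i + 1)) - K%:Z - X 0 i * D.
    by rewrite h; ring.
  by rewrite /D; ring.
have y0 i : 0 <= y 0 i by exact: f_ge0.
have z0 i : 0 <= z 0 i.
  have : 0 < 4%:Z * d%:Z * (K%:Z * (z 0 i + 1)).
    rewrite !mulrDr mulr1 zE; have := r0 i; have := eb i.
    have : 0 <= D * y 0 i by rewrite mulr_ge0 // ltW.
    have : 4%:Z * d%:Z * e i <= 4%:Z * d%:Z * `|e i| by rewrite ler_wpM2l // ler_norm.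
    by lia.
  by rewrite !pmulr_rgt0 //; lia.
exists z; split=> //; last by exists l; rewrite /z subKr.
have nz : l1norm z = \sum_i z 0 i.
  by apply: eq_bigr => i _; rewrite ger0_norm.
have ny : \sum_i y 0 i <= k%:Z.
  rewrite (le_trans _ (f_norm (psi X))) //; apply: ler_sum => i _.
  exact: ler_norm.
have sum_cst (c : int) : \sum_(i < d) c = d%:Z * c.
  by rewrite sumr_const card_ord -mulr_natl natz.
have : 4%:Z * d%:Z * (K%:Z * l1norm z) < \sum_(i < d) D - d%:Z * (4%:Z * d%:Z * K%:Z)
   + d%:Z * K%:Z + D * k%:Z + d%:Z * K%:Z.
  rewrite nz !mulr_sumr.
  apply: (@lt_le_trans _ _ (\sum_i (D - 4%:Z * d%:Z * K%:Z + K%:Z + D * y 0 i + K%:Z))).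
    apply: ltr_sum => [|i _].
      by apply/hasP; exists (Ordinal d_gt0); rewrite ?mem_index_enum.
    rewrite zE; have := rD i; have := eb i.
    have : 4%:Z * d%:Z * - e i <= 4%:Z * d%:Z * `|e i|.
      by rewrite ler_wpM2l // -normrN ler_norm.
    have : 0 <= 4%:Z * d%:Z * `|e i| by rewrite !mulr_ge0.
    by lia.
  rewrite !big_split /= -[X in _ + X + _ <= _]mulr_sumr !sum_cst.
  by rewrite mulrN lerD2r lerD2l ler_pM2l.
rewrite sum_cst => h.
(* Because [K = k + d], the terms [d D] and [D k] add up to [D K], which is the main term [4 d K m];
   the two slack terms [d K] fit into the [4 d K] granted by the final [+ 1]. *)
have : 4%:Z * d%:Z * (K%:Z * l1norm z) < 4%:Z * d%:Z * (K%:Z * (m%:Z - d%:Z + 1)).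
  apply: (lt_le_trans h); rewrite /D PoszD.
  have : 0 <= d%:Z * (k%:Z + d%:Z) by [].
  by lia.
by rewrite !ltr_pM2l //; lia.
Qed.

Lemma dilated_covers : (d <= m)%N /\ simplex_covers dilated (m - d).
Proof.
have cover (x : 'rV[int]_d) : exists z : 'rV[int]_d,
    [/\ forall i, 0 <= z 0 i, l1norm z + d%:Z <= m%:Z & dilated (x - z)].
  have [y [xy /dilated_cover_bounded[z [z0 zn yz]]]] := dilated_reduction x.
  exists z; split=> //; rewrite -(subrK y x) -addrA.
  exact: mod_subD dilated_mod_sub xy yz.
have dm : (d <= m)%N.
  by have [z [_ + _]] := cover 0; have := l1norm_ge0 z; lia.
split=> // x; have [z [z0 zn xz]] := cover x.
by exists z; split=> //; lia.
Qed.

(** This keeps the degree equal to [d]: the [e_i] and their differences have entries of size at most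
    1, so their classes are nonzero. The preimage [l] of [p] has entries below [2K / m]; as
    [Q <= m], its multiples up to [Q] stay in the packing box, two coincide, [l = 0], and the error
    bound gives [p = 0]. *)
Lemma dilated_short (Q : nat) p : ((5 * K) ^ d < Q.+1 * #|G|)%N -> (Q <= m)%N ->
  dilated p -> (forall i, `|p 0 i| <= 1) -> p = 0.
Proof.
move=> hQ Qm [l lp] pb.
have d1 : 0 < d%:Z by []. have m1 : 0 < m%:Z by [].
have K1 : 0 < K%:Z by rewrite ltz_nat addn_gt0 d_gt0 orbT.
have lb i : m%:Z * `|l 0 i| < 2%:Z * K%:Z.
  have := near_dilation_entry i lp pb; rewrite mulr1 => h.
  have : `|K%:Z * p 0 i - m%:Z * l 0 i| < K%:Z.
    rewrite -(@ltr_pM2l _ (20%:Z * d%:Z * m%:Z)); last by nia.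
    apply: (le_lt_trans h); have : 1 <= d%:Z * m%:Z by nia.
    by nia.
  have <- : `|m%:Z * l 0 i| = m%:Z * `|l 0 i| by rewrite normrM ger0_norm.
  have : `|K%:Z * p 0 i| <= K%:Z.
    by rewrite normrM ger0_norm // ler_piMr.
  by lia.
have [||i [j [ij]]] := @kernel_packing _ _ psi _ _ d_gt0 f_ge0 f_norm psi_f
    _ (fun j : 'I_Q.+1 => j%:Z *: l) _ _ hQ.
- move=> j; rewrite -[j%:Z]intz scaler_int raddfMz.
  by rewrite (nd_kernel Ldil lp) mul0rz.
- move=> j i; rewrite entryZ normrM ger0_norm // PoszM.
  apply: le_lt_trans (lb i); rewrite ler_wpM2r // lez_nat.
  by rewrite (leq_trans _ Qm) // -ltnS.
move=> /rowP hij; have l0 : l = 0.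
  apply/rowP => a; have := hij a; rewrite !entryZ entry0; nia.
apply: l1norm_eq0; have : l1norm p <= d%:Z * 0; last by rewrite mulr0.
apply: l1norm_le => a; have := nd_error Ldil lp a.
have -> : l1norm l = 0 by rewrite l0 l1norm_0.
rewrite l0 entry0 mulr0 subr0 normrM ger0_norm //.
have : 1 <= (40 * (d * d))%N%:Z by nia.
have : 0 <= `|p 0 a| by [].
by nia.
Qed.

(** Up to a factor [(1 + 1 / (5 m)) ^ d], the index grows at least by [(m / K) ^ d], as for an exact
    dilation. *)
Lemma dilated_index (G' : finZmodType) (pi : {additive 'rV[int]_d -> G'})
    (f' : G' -> 'rV[int]_d) :
  (forall x, pi x = 0 -> dilated x) -> cancel f' pi ->
  (forall g i, 0 <= f' g 0 i) -> (forall g, l1norm (f' g) <= m%:Z) ->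
  ((5 * m ^ 2) ^ d * #|G| <= #|G'| * (K * (5 * m + 1)) ^ d)%N.
Proof.
move=> piK pif f'0 f'm.
have d1 : 0 < d%:Z by []. have m1 : 0 < m%:Z by [].
have K1 : 0 < K%:Z by rewrite ltz_nat addn_gt0 d_gt0 orbT.
(* A point [x] of a large box and an element [g] of [G] are encoded by the class
   of [x] in [G'] and the point [l + f g], where [l] is the kernel vector
   corresponding to the point of the dilated lattice underneath [x]. *)
pose R := (20 * m ^ 2)%N.
pose v (F : {ffun 'I_d -> 'I_R}) : 'rV[int]_d := \row_i (F i)%:Z.
have lex F : exists l, L l (v F - f' (pi (v F))).
  by apply: piK; rewrite raddfB pif subrr.
pose l F := projT1 (cid (lex F)).
have lP F : L (l F) (v F - f' (pi (v F))) := projT2 (cid (lex F)).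
have vE F i : v F 0 i = (F i)%:Z by rewrite mxE.
(* Scaling a box of side [20 m^2] by [K / m] gives side [20 m K], and boundary effects add only
   [4 K], a relative loss of [1 / (5 m)]. *)
suff : (#|{: {ffun 'I_d -> 'I_R} * G}|
    <= #|{: G'}| * (K * (20 * m + 4)) ^ d)%N.
  rewrite card_prod card_ffun !card_ord.
  have -> : R = (4 * (5 * m ^ 2))%N by rewrite /R; lia.
  have -> : (K * (20 * m + 4) = 4 * (K * (5 * m + 1)))%N by lia.
  by rewrite !(expnMn 4) -mulnA [leqRHS]mulnCA leq_pmul2l // expn_gt0.
apply: (@card_le_box d _ _ (fun u => pi (v u.1)) (fun u => l u.1 + f u.2)
  (- (2%:Z * K%:Z))).
  move=> [F g] [F' g'] /= [] ep el.
  have gg : g = g'.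
    move: (congr1 psi el); rewrite !raddfD !psi_f.
    by rewrite !(nd_kernel Ldil (lP _)) !add0r.
  move: el; rewrite gg => /addIr el.
  congr pair; apply/ffunP => i; apply/val_inj.
  (* Two points with the same class and the same [l] differ by an image of 0, which the error bound
     forces to vanish. *)
  have := nd_error Ldil (nd_sub Ldil (lP F) (lP F')) i.
  rewrite el ep subrr opprB addrA subrK.
  rewrite l1norm_0.
  rewrite entry0 mulr0 subr0 entryB !vE normrM ger0_norm // => h.
  apply/eqP; rewrite -eqz_nat -subr_eq0 -normr_eq0 eq_le normr_ge0 andbT.
  move: h; rewrite pmulr_rle0 ?pmulr_rle0 //; lia.
move=> [F g] i /=; rewrite entryD.
pose p := v F - f' (pi (v F)).
have f'i j : f' (pi (v F)) 0 j <= m%:Z := section_entry_le f'0 f'm _ _.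
have pE j : p 0 j = (F j)%:Z - f' (pi (v F)) 0 j by rewrite entryB vE.
have RE : R%:Z = 20%:Z * (m%:Z * m%:Z) by rewrite /R; lia.
have pb j : `|p 0 j| <= R%:Z.
  have : m%:Z <= m%:Z * m%:Z by nia.
  by rewrite pE; have := f'i j; have := f'0 (pi (v F)) j; have := ltn_ord (F j); lia.
have := near_dilation_entry i (lP F) pb; rewrite -/p RE => h.
have eb : `|K%:Z * p 0 i - m%:Z * l F 0 i| <= K%:Z * m%:Z.
  rewrite -(@ler_pM2l _ (20%:Z * d%:Z * m%:Z)); last by nia.
  apply: (le_trans h); have : K%:Z * m%:Z * m%:Z <= d%:Z * (K%:Z * m%:Z * m%:Z).
    by rewrite ler_peMl // !mulr_ge0.
  by lia.
have lb : - (2%:Z * K%:Z) <= l F 0 i.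
  rewrite -(@ler_pM2l _ m%:Z) //.
  have : K%:Z * (- m%:Z) <= K%:Z * p 0 i.
    by rewrite ler_pM2l // pE; have := f'i i; lia.
  by lia.
have ub : l F 0 i <= K%:Z * (20%:Z * m%:Z + 1).
  rewrite -(@ler_pM2l _ m%:Z) //.
  have : K%:Z * p 0 i <= K%:Z * (20%:Z * (m%:Z * m%:Z)).
    rewrite ler_pM2l // pE -RE.
    by have := f'0 (pi (v F)) i; have := ltn_ord (F i); lia.
  by lia.
have := f_ge0 g i; have := section_entry_le f_ge0 f_norm g i.
by lia.
Qed.

End Dilation.

(** * Finite quotients of Z^d *)

Lemma exists_finite_quotient (d : nat) (M : 'rV[int]_d -> Prop) (k : nat) :
  mod_sub M -> simplex_covers M k ->
  exists (G : finZmodType) (pi : {additive 'rV[int]_d -> G})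
         (f : G -> 'rV[int]_d),
    [/\ cancel f pi, forall x, pi x = 0 <-> M x,
        (forall g i, 0 <= f g 0 i) & (forall g, l1norm (f g) <= k%:Z)].
Proof.
move=> hM cov; pose P : pred 'rV[int]_d := fun x => `[< M x >].
have Pclosed : zmod_closed P.
  split; first by apply/asboolP; exact: hM.1.
  by move=> x y /asboolP Mx /asboolP My; apply/asboolP; exact: hM.2.
pose I : zmodClosed 'rV[int]_d :=
  HB.pack P (GRing.isZmodClosed.Build 'rV[int]_d P Pclosed).
pose Q : zmodType := Quotient.quot I.
pose pi0 : {additive 'rV[int]_d -> Q} := (\pi_(Quotient.quot I))%qT.
pose f0 (q : Quotient.quot I) := projT1 (cid (cov (generic_quotient.repr q))).
have f0P (q : Quotient.quot I) : [/\ forall i, 0 <= f0 q 0 i, l1norm (f0 q) <= k%:Z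
    & M (generic_quotient.repr q - f0 q)] := projT2 (cid (cov (generic_quotient.repr q))).
have pi0E x y : pi0 x = pi0 y <-> M (x - y).
  split => [/eqP|/asboolP Mxy]; [|apply/eqP]; rewrite -Quotient.idealrBE //.
  by move=> /asboolP.
have f0K (q : Quotient.quot I) : pi0 (f0 q) = q.
  by rewrite -[RHS]generic_quotient.reprK; apply/esym/pi0E; have [_ _] := f0P q.
have f0k (q : Quotient.quot I) (i : 'I_d) : (absz (f0 q 0%R i) < k.+1)%N.
  have [f00 fk _] := f0P q.
  suff : f0 q 0 i <= l1norm (f0 q) by have := f00 i; lia.
  by rewrite /l1norm (bigD1 i) //= ger0_norm // lerDl sumr_ge0.
(* Representatives with entries from 0 to [k] encode the classes, which supplies the countable and
   finite structures. *)
pose enc (q : Quotient.quot I) : {ffun 'I_d -> 'I_k.+1} := [ffun i => Ordinal (f0k q i)].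
pose dec (F : {ffun 'I_d -> 'I_k.+1}) : Q := pi0 (\row_i (F i)%:Z).
have encK : cancel enc dec.
  move=> q; rewrite /dec -[RHS]f0K; congr (pi0 _); apply/rowP => i.
  by rewrite mxE ffunE /= gez0_abs //; have [] := f0P q.
pose CQ : countType := HB.pack (Quotient.quot I) (CanIsCountable encK).
pose FQ : finZmodType := HB.pack (Quotient.quot I) (CanIsCountable encK)
  (@CanIsFinite CQ _ _ _ encK).
exists FQ, pi0, f0; split=> //.
- by move=> x; rewrite -[x in M x]subr0 -pi0E raddf0.
- by move=> g; have [] := f0P g.
- by move=> g; have [] := f0P g.
Qed.

(** * Walks and distances; Cayley digraphs as coverings of Z^d by simplices *)

Section Distance.
Variables (V : finType) (e : rel V).

Lemma has_walkP (k : nat) (x y : V) :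
  reflect (exists p, [/\ size p = k, path e x p & last x p = y])
          (has_walk e k x y).
Proof.
apply: (iffP existsP) => [[p /andP[xp /eqP py]]|[p [sp xp py]]].
  by exists p; rewrite size_tuple.
by move/eqP: sp => sp; exists (Tuple sp); rewrite /= xp py eqxx.
Qed.

Lemma ddist_le (k : nat) (x y : V) : has_walk e k x y -> (ddist e x y <= k)%N.
Proof.
move=> w; have [kV|Vk] := ltnP k #|V|.
  rewrite /ddist; have : Ordinal kV \in index_enum 'I_#|V| by exact: mem_index_enum.
  elim: (index_enum _) => // j r IH; rewrite inE big_cons.
  have [jP|jP] := boolP (has_walk e j x y).
    by move=> /predU1P[<-|/IH]; rewrite geq_min ?leqnn //= => ->; rewrite orbT.
  by move=> /predU1P[jE|/IH //]; rewrite -jE w in jP.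
(* A walk with at least [#|V|] arcs is outside the range of the minimum, which however never exceeds
   its default value [#|V|]. *)
apply: leq_trans Vk; rewrite /ddist; elim/big_rec: _ => // j n _ nV.
by rewrite geq_min nV orbT.
Qed.

(** A walk without repeated vertices has fewer than [#|V|] arcs, so the minimum is not the default
    value and is attained. *)
Lemma connect_ddist (x y : V) : connect e x y -> has_walk e (ddist e x y) x y.
Proof.
move=> /connectP[p /shortenP[p' xp' up' _] yE].
have w : has_walk e (size p') x y by apply/has_walkP; exists p'.
have p'V : (size p' < #|V|)%N.
  by have := max_card (mem (x :: p')); rewrite (card_uniqP up').
have : ddist e x y = #|V| \/ has_walk e (ddist e x y) x y.
  rewrite /ddist; elim/big_rec: _ => [|j n wj IH]; first by left.
  by rewrite /minn; case: ifP => _; [right|].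
by case=> // dV; have := ddist_le w; rewrite dV leqNgt p'V.
Qed.

Lemma ddist_le_diameter (x y : V) : (ddist e x y <= diameter e)%N.
Proof.
exact: leq_trans (leq_bigmax y) (leq_bigmax (F := fun x => \max_y ddist e x y) x).
Qed.

End Distance.

(** In a finite group every element of a generated subgroup is a product of generators without
    inverses, so directed walks suffice. *)
Lemma cayley_connect (Gamma : abelianCayley) (g : cayley_group Gamma) :
  connect (@Defs.arc Gamma) 0 g.
Proof.
have : g \in <<cayley_gens Gamma>>%g by rewrite cayley_gens_generate inE.
move=> /gen_prodgP[n [c cT ->]]; elim: n c cT => [|n IH] c cT.
  by rewrite big_ord0.
rewrite big_ord_recr /=; apply: connect_trans (IH _ (fun i => cT _)) (connect1 _).
by apply/existsP; exists (c ord_max); rewrite cT /= FinRing.zmodMgE.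
Qed.

(** [psi] sends [e_i] to the i-th generator, and [f g] counts the uses of each generator in a
    shortest walk from 0 to [g]; commutativity makes the order of the arcs irrelevant. *)
Lemma cayley_simplex_section (Gamma : abelianCayley) (d : nat) :
  cayley_degree Gamma = d ->
  exists (psi : {additive 'rV[int]_d -> cayley_group Gamma})
         (f : cayley_group Gamma -> 'rV[int]_d),
    [/\ cancel f psi, (forall g i, 0 <= f g 0 i)
      & (forall g, l1norm (f g) <= (cayley_diam Gamma)%:Z)].
Proof.
move=> dE; pose t (i : 'I_d) : cayley_group Gamma := enum_val (cast_ord (esym dE) i).
have tS a : a \in cayley_gens Gamma -> exists i, t i = a.
  move=> aT; exists (cast_ord dE (enum_rank_in aT a)).
  by rewrite /t cast_ordK enum_rankK_in.
pose psi0 (x : 'rV[int]_d) := \sum_i t i *~ x 0 i.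
have psi0B : zmod_morphism psi0.
  move=> x y; rewrite /psi0 -sumrB; apply: eq_bigr => i _.
  by rewrite entryB mulrzBr.
have [psi psiE] : exists psi : {additive 'rV[int]_d -> cayley_group Gamma},
    psi =1 psi0.
  pose psi1 : {additive 'rV[int]_d -> cayley_group Gamma} :=
    HB.pack psi0 (GRing.isZmodMorphism.Build _ _ psi0 psi0B).
  by exists psi1.
have psi_delta i : psi (delta_mx 0 i) = t i.
  rewrite psiE /psi0 (bigD1 i) //= entry_delta eqxx big1 ?addr0 // => j ji.
  by rewrite entry_delta (negPf ji).
have walk p x : path (@Defs.arc Gamma) x p -> exists y : 'rV[int]_d,
    [/\ forall i, 0 <= y 0 i, l1norm y <= (size p)%:Z & last x p = x + psi y].
  elim: p x => [|a p IH] x /=.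
    exists 0; split; first by move=> i; rewrite entry0.
      by rewrite l1norm_0.
    by rewrite raddf0 addr0.
  move=> /andP[/existsP[b /andP[/tS[i <-] /eqP ->]]] /IH[y [y0 yp ->]].
  exists (delta_mx 0 i + y); split.
  - by move=> j; rewrite entryD entry_delta addr_ge0.
  - rewrite (le_trans (ler_l1normD _ _)) // l1norm_delta.
    by rewrite -[(size p).+1]add1n PoszD lerD2l.
  - by rewrite raddfD psi_delta addrA.
have sec g : exists y : 'rV[int]_d, [/\ psi y = g, forall i, 0 <= y 0 i
    & l1norm y <= (cayley_diam Gamma)%:Z].
  have /has_walkP[p [sp /walk[y [y0 yp py]] pg]] := connect_ddist (cayley_connect g).
  exists y; split=> //; first by rewrite -pg py add0r.
  by rewrite (le_trans yp) // sp lez_nat ddist_le_diameter.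
pose f g := projT1 (cid (sec g)).
have fP g : [/\ psi (f g) = g, forall i, 0 <= f g 0 i
    & l1norm (f g) <= (cayley_diam Gamma)%:Z] := projT2 (cid (sec g)).
by exists psi, f; split=> g; have [] := fP g.
Qed.

Lemma row_sum_delta (d : nat) (y : 'rV[int]_d) : (forall i, 0 <= y 0 i) ->
  exists s : seq 'I_d, (size s)%:Z = l1norm y /\ y = \sum_(i <- s) delta_mx 0 i.
Proof.
have [n] := ubnP (absz (l1norm y)); elim: n y => // n IH y yn y0.
have [/existsP[i yi]|] := boolP [exists i, 0 < y 0 i]; last first.
  rewrite negb_exists => /forallP yi.
  have -> : y = 0.
    apply/rowP => i; rewrite entry0; have := y0 i; have := yi i; lia.
  by exists [::]; rewrite l1norm_0 big_nil.
have := @ler_l1norm_sub_delta _ 1 y i isT; rewrite gtr0_norm // gtr0_sg // mul1r.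
move=> /(_ yi) yle.
have := ler_l1normD (y - 1 *: delta_mx 0 i) (delta_mx 0 i).
rewrite scale1r subrK l1norm_delta in yle * => yge.
have [||s [ss yE]] := IH (y - delta_mx 0 i).
- by have := l1norm_ge0 (y - delta_mx 0 i); lia.
- move=> j; rewrite entryB entry_delta; have := y0 j; case: eqP => [->|] /=; lia.
exists (i :: s); rewrite big_cons -yE [_ + (_ - _)]addrC subrK; split=> //=.
by lia.
Qed.

(** Converse passage from lattice to digraph: [f g], split into basis vectors, is a walk of length
    at most [k]. The last two hypotheses keep 0 out of the generating set and the degree equal to
    [d]. *)
Lemma exists_cayley (d : nat) (G : finZmodType) (pi : {additive 'rV[int]_d -> G})
    (k : nat) (f : G -> 'rV[int]_d) :
  cancel f pi -> (forall g i, 0 <= f g 0 i) -> (forall g, l1norm (f g) <= k%:Z) ->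
  (forall i, pi (delta_mx 0 i) != 0) ->
  injective (fun i : 'I_d => pi (delta_mx 0 i)) ->
  exists Gamma : abelianCayley, [/\ cayley_order Gamma = #|G|,
    cayley_degree Gamma = d & (cayley_diam Gamma <= k)%N].
Proof.
move=> fK f0 fk e0 einj; pose t i := pi (delta_mx 0 i).
pose T : {set G} := [set t i | i : 'I_d].
have T0 : 0 \notin T.
  by apply/imsetP => -[i _ /esym/eqP]; rewrite (negPf (e0 i)).
have piE g : exists2 s : seq 'I_d, (size s <= k)%N & g = \sum_(i <- s) t i.
  have [s [ss fE]] := row_sum_delta (f0 g).
  exists s; first by rewrite -lez_nat ss fk.
  by rewrite -[LHS]fK fE raddf_sum.
have Tgen : <<T>>%g = [set: G].
  apply/setP => g; rewrite inE; have [s _ ->] := piE g.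
  elim: s => [|i s IH]; first by rewrite big_nil -FinRing.zmod1gE group1.
  by rewrite big_cons -FinRing.zmodMgE groupM // mem_gen // imset_f.
pose Gamma := AbelianCayley T0 Tgen; exists Gamma; split=> //.
  by rewrite /cayley_degree /= card_imset // card_ord.
apply/bigmax_leqP => x _; apply/bigmax_leqP => y _.
have [s sk yx] := piE (y - x).
apply: leq_trans sk; apply: ddist_le; apply/has_walkP.
have {yx} yE : y = x + \sum_(i <- s) t i by rewrite -yx addrC subrK.
rewrite yE; elim: s x {yE} => [|i s IH] x.
  by exists [::]; rewrite big_nil addr0.
have [p [sp xp pE]] := IH (x + t i).
exists (x + t i :: p); rewrite /= sp xp pE big_cons addrA andbT; split=> //.
by apply/existsP; exists (t i); rewrite imset_f //=.
Qed.

(** The complete digraph: all nonzero elements of the cyclic group of order [d + 1]. *)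
Lemma exists_cayley_degree (d : nat) : (0 < d)%N ->
  exists Gamma : abelianCayley, cayley_degree Gamma = d.
Proof.
case: d => // d _; pose T := [set~ 0 : 'I_d.+2].
have T0 : 0 \notin T by rewrite !inE eqxx.
have Tgen : <<T>>%g = [set: 'I_d.+2].
  apply/setP => g; rewrite [RHS]inE; have [->|g0] := eqVneq g 0; first exact: group1.
  by rewrite mem_gen // !inE.
exists (AbelianCayley T0 Tgen).
by rewrite /cayley_degree /= cardsC1 card_ord.
Qed.

Lemma cayley_order_le (Gamma : abelianCayley) (d : nat) : (0 < d)%N ->
  cayley_degree Gamma = d ->
  (cayley_order Gamma <= (cayley_diam Gamma + d) ^ d)%N.
Proof.
move=> d0 dE; have [psi [f [fK f0 fk]]] := cayley_simplex_section dE.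
have := @card_le_box d (cayley_group Gamma) unit (fun=> tt) f 0
  (cayley_diam Gamma + d).
rewrite card_unit mul1n; apply; first by move=> g h [/(can_inj fK)].
move=> g i; rewrite f0 /=; have := section_entry_le f0 fk g i; lia.
Qed.

(** The upper bound on [m] involves only [d], [Q] and [m0], so the density of [Gamma] can be
    prescribed after this bound is known. *)
Lemma exists_cayley_dilation (Gamma : abelianCayley) (d Q m0 : nat) :
  (0 < d)%N -> cayley_degree Gamma = d ->
  ((5 * (cayley_diam Gamma + d)) ^ d < Q.+1 * cayley_order Gamma)%N ->
  (0 < m0)%N -> (Q <= m0)%N ->
  exists (Gamma' : abelianCayley) (m : nat),
    [/\ cayley_degree Gamma' = d, (cayley_diam Gamma' + d <= m)%N,
        (m <= m0 * (Q`! * (40 * (d * d))) ^ (d * d))%N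
      & ((5 * m ^ 2) ^ d * cayley_order Gamma <= cayley_order Gamma' *
          ((cayley_diam Gamma + d) * (5 * m + 1)) ^ d)%N].
Proof.
move=> d0 dE hQ m00 Qm0.
have [psi [f [fK f0 fk]]] := cayley_simplex_section dE.
have S0 : (0 < 40 * (d * d))%N by rewrite !muln_gt0 d0.
have [m [L [m0m mle Ldil]]] := exists_near_dilation d0 f0 fk fK hQ S0 m00.
have m_gt0 : (0 < m)%N by exact: leq_trans m0m.
have [dm cov] := dilated_covers d0 f0 fk fK m_gt0 Ldil.
have [G [pi [g [gK piK g0 gk]]]] :=
  exists_finite_quotient (dilated_mod_sub Ldil) cov.
have short (x : 'rV[int]_d) : (forall i, `|x 0 i| <= 1) -> pi x = 0 -> x = 0.
  move=> x1 /piK Mx; apply: (dilated_short d0 f0 fk fK m_gt0 Ldil hQ) Mx x1.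
  exact: leq_trans m0m.
have delta0 i : pi (delta_mx 0 i) != 0.
  apply/eqP => /short di; have /rowP/(_ i) : delta_mx 0 i = 0 :> 'rV[int]_d.
    by apply: di => j; rewrite entry_delta; case: eqP.
  by rewrite entry_delta entry0 eqxx.
have delta_inj : injective (fun i : 'I_d => pi (delta_mx 0 i)).
  move=> i j /eqP; rewrite -subr_eq0 -raddfB => /eqP /short dij.
  have /rowP/(_ i) : delta_mx 0 i - delta_mx 0 j = 0 :> 'rV[int]_d.
    by apply: dij => a; rewrite entryB !entry_delta; do 2 case: eqP.
  by rewrite entryB !entry_delta entry0 eqxx; case: eqP.
have [Gamma' [nE dE' kE]] := exists_cayley gK g0 gk delta0 delta_inj.
exists Gamma', m; split=> //.
  by rewrite -(subnK dm) leq_add2r.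
rewrite nE; apply: (dilated_index d0 f0 fk fK m_gt0 Ldil _ gK g0) => [x|h].
  by move/piK.
by rewrite (le_trans (gk h)) // lez_nat leq_subr.
Qed.

(** * Digraphs of density close to the supremum *)

Section GlobalDensity.
Variables (R : realType) (d : nat).
Hypothesis d_gt0 : (0 < d)%N.

Local Notation Delta := (global_solid_density R d).
Local Notation densities := [set x : R | exists2 Gamma : abelianCayley,
  cayley_degree Gamma = d & x = solid_density R Gamma]%classic.

Lemma solid_densityE (Gamma : abelianCayley) : cayley_degree Gamma = d ->
  (cayley_order Gamma)%:R =
    solid_density R Gamma * (cayley_diam Gamma + d)%:R ^+ d.
Proof.
move=> dE; rewrite /solid_density dE divfK // expf_neq0 // pnatr_eq0.
by rewrite -lt0n addn_gt0 d_gt0 orbT.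
Qed.

Lemma solid_density_le1 (Gamma : abelianCayley) : cayley_degree Gamma = d ->
  solid_density R Gamma <= 1.
Proof.
move=> dE; rewrite /solid_density dE ler_pdivrMr; last first.
  by rewrite exprn_gt0 // ltr0n addn_gt0 d_gt0 orbT.
by rewrite mul1r -natrX ler_nat cayley_order_le.
Qed.

Lemma densities_has_sup : has_sup densities.
Proof.
split; last by exists 1 => x [Gamma dE ->]; exact: solid_density_le1.
have [Gamma dE] := exists_cayley_degree d_gt0.
by exists (solid_density R Gamma), Gamma.
Qed.

Lemma solid_density_le (Gamma : abelianCayley) : cayley_degree Gamma = d ->
  solid_density R Gamma <= Delta.
Proof.
move=> dE; apply: ub_le_sup; last by exists Gamma.
exact: densities_has_sup.2.
Qed.

Lemma global_solid_density_gt0 : 0 < Delta.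
Proof.
have [Gamma dE] := exists_cayley_degree d_gt0.
apply: lt_le_trans (solid_density_le dE).
rewrite /solid_density dE divr_gt0 ?exprn_gt0 ?ltr0n //.
  by apply/card_gt0P; exists 0.
by rewrite addn_gt0 d_gt0 orbT.
Qed.

(** This is what tightness requires: the root in the bound exceeds [m - 1], so its ceiling is at
    least [m]. *)
Lemma exists_dense_cayley :
  exists (Gamma : abelianCayley) (m : nat), [/\ cayley_degree Gamma = d,
    (cayley_diam Gamma + d <= m)%N & Delta * m.-1%:R ^+ d < (cayley_order Gamma)%:R].
Proof.
have D0 := global_solid_density_gt0.
(* With this [Q], every digraph of density at least [Delta / 2] satisfies the counting hypothesis of
   [exists_cayley_dilation]. *)
pose Q := Num.truncn (5 ^+ d / (Delta / 2)).
have hQ : 5 ^+ d < Q.+1%:R * (Delta / 2).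
  by rewrite -ltr_pdivrMr ?divr_gt0 // truncnS_gt.
(* A bound for [m] fixed before the digraph; the density defect is then required to be less than
   [Delta / (2 m1)]. *)
pose m1 := (Q.+1 * (Q`! * (40 * (d * d))) ^ (d * d))%N.
have m1_gt0 : (0 < m1)%N.
  by rewrite /m1 muln_gt0 expn_gt0 muln_gt0 fact_gt0 !muln_gt0 d_gt0.
have m1_ge1 : 1 <= m1%:R :> R by rewrite ler1n.
have e_gt0 : 0 < Delta / (2 * m1%:R) by rewrite divr_gt0 // mulr_gt0 // ltr0n.
have [_ [Gamma dE ->] nD] := sup_adherent e_gt0 densities_has_sup.
rewrite -/Delta in nD.
set n := cayley_order Gamma; set K := (cayley_diam Gamma + d)%N.
have K_gt0 : 0 < K%:R ^+ d :> R.
  by rewrite exprn_gt0 // ltr0n addn_gt0 d_gt0 orbT.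
have nE : n%:R = solid_density R Gamma * K%:R ^+ d :> R by exact: solid_densityE.
have hQn : ((5 * K) ^ d < Q.+1 * n)%N.
  rewrite -(ltr_nat R) natrX !natrM exprMn nE mulrA ltr_pM2r //.
  apply: (lt_le_trans hQ); rewrite ler_pM2l // ltW //.
  apply: le_lt_trans nD; rewrite lerBrDr -lerBrDl -{2}[Delta]mulr1.
  have -> : Delta * 1 - Delta / 2 = Delta / 2 by field.
  by rewrite ler_pM2l // lef_pV2 ?posrE ?mulr_gt0 ?ltr0n // ler_peMr.
have [Gamma' [m [dE' km mm1 hm]]] :=
  exists_cayley_dilation (m0 := Q.+1) d_gt0 dE hQn isT (leqnSn Q).
exists Gamma', m; split=> //; rewrite ltNge; apply/negP => n'le.
have m_gt0 : (0 < m)%N by apply: leq_trans km; rewrite addn_gt0 d_gt0 orbT.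
have m_gt0R : 0 < m%:R :> R by rewrite ltr0n.
have m_ge1 : 1 <= m%:R :> R by rewrite ler1n.
have mpred : m.-1%:R = m%:R - 1 :> R by rewrite -subn1 natrB.
pose q : R := 1 - (2 * m%:R)^-1.
have hq : q <= 1 - (2 * m1%:R)^-1.
  by rewrite lerD2l lerN2 lef_pV2 ?posrE ?mulr_gt0 ?ltr0n // ler_pM2l // ler_nat.
have q0 : 0 <= q.
  rewrite subr_ge0 invf_le1 ?mulr_gt0 //.
  by lra.
have q1 : q <= 1 by rewrite lerBlDr lerDl invr_ge0 mulr_ge0.
(* If the order of [Gamma'] were at most [Delta (m - 1)^d], this strict inequality would follow; it
   is absurd because [q ^ d <= q <= 1 - 1 / (2 m1)]. *)
suff : (5 * m%:R ^+ 2) ^+ d * (1 - (2 * m1%:R)^-1) < (5 * m%:R ^+ 2 * q) ^+ d.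
  rewrite [ltRHS]exprMn ltr_pM2l ?exprn_gt0 ?mulr_gt0 ?exprn_gt0 //.
  move=> /lt_le_trans/(_ (ler_iXnr d_gt0 q0 q1)).
  by rewrite ltNge hq.
rewrite -(@ltr_pM2l _ (Delta * K%:R ^+ d)) ?mulr_gt0 //.
apply: (@lt_le_trans _ _ ((5 * m%:R ^+ 2) ^+ d * n%:R)).
  rewrite mulrCA ltr_pM2l ?exprn_gt0 ?mulr_gt0 ?exprn_gt0 //.
  rewrite nE mulrAC ltr_pM2r //; apply: le_lt_trans nD.
  by rewrite mulrBr mulr1.
apply: (@le_trans _ _ ((cayley_order Gamma')%:R * (K%:R * (5 * m%:R + 1)) ^+ d)).
  move: hm; rewrite -/K -(ler_nat R).
  by rewrite !(natrM, natrX) [(5 * m + 1)%:R]natrD natrM.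
apply: (@le_trans _ _ (Delta * m.-1%:R ^+ d * (K%:R * (5 * m%:R + 1)) ^+ d)).
  by rewrite ler_wpM2r // exprn_ge0 // mulr_ge0 // addr_ge0 // mulr_ge0.
rewrite exprMn mulrACA -exprMn ler_wpM2l ?(ltW (mulr_gt0 _ _)) //.
rewrite ler_pXn2r // ?nnegrE; first last.
- by rewrite !mulr_ge0 // exprn_ge0.
- by rewrite mulr_ge0 // addr_ge0 // mulr_ge0.
(* What remains is [(5 m + 1)(m - 1) = 5 m^2 - 4 m - 1 <= 5 m^2 - 5 m / 2]. *)
have -> : 5 * m%:R ^+ 2 * q = 5 * m%:R ^+ 2 - 5 / 2 * m%:R.
  by rewrite /q; field; rewrite pnatr_eq0 -lt0n.
by rewrite mpred; nra.
Qed.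

End GlobalDensity.

(** * The lower bound and its tightness *)

Lemma powR_inv_expr (R : realType) (d : nat) (a : R) : (0 < d)%N -> 0 <= a ->
  (a `^ d%:R^-1) ^+ d = a.
Proof.
move=> d0 a0; rewrite -powR_mulrn ?powR_ge0 // -powRrM mulVf ?powRr1 //.
by rewrite pnatr_eq0 -lt0n.
Qed.

Lemma kappaP (d n : nat) : realizable d n ->
  (exists Gamma : abelianCayley, [/\ cayley_order Gamma = n,
     cayley_degree Gamma = d & cayley_diam Gamma = kappa d n]) /\
  (forall Gamma : abelianCayley, cayley_order Gamma = n ->
     cayley_degree Gamma = d -> (kappa d n <= cayley_diam Gamma)%N).
Proof.
move=> [Gamma0 [n0 d0]]; rewrite /kappa; case: pselect => [ex_k|nex]; last first.
  by case: nex; exists (cayley_diam Gamma0); apply/asboolP; exists Gamma0.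
case: ex_minnP => k /asboolP kP kmin; split=> // Gamma nE dE.
by apply: kmin; apply/asboolP; exists Gamma.
Qed.

Theorem theorem2 (R : realType) (d : nat) (hd : (1 <= d)%N) :
  (forall n : nat, realizable d n ->
     Num.ceil ((n%:R / global_solid_density R d) `^ (d%:R^-1)) - d%:Z
       <= (kappa d n)%:Z) /\
  (exists n : nat, realizable d n /\
     (kappa d n)%:Z =
     Num.ceil ((n%:R / global_solid_density R d) `^ (d%:R^-1)) - d%:Z).
Proof.
have D0 := global_solid_density_gt0 R hd.
have lower n : realizable d n ->
    Num.ceil ((n%:R / global_solid_density R d) `^ (d%:R^-1)) - d%:Z
      <= (kappa d n)%:Z.
  move=> /kappaP [[Gamma [nE dE kE]] _].
  rewrite lerBlDr -PoszD ceil_le_int -pmulrn.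
  rewrite -(@ler_pXn2r _ d) ?nnegrE ?powR_ge0 //.
  rewrite powR_inv_expr ?divr_ge0 ?(ltW D0) // ler_pdivrMr // mulrC.
  rewrite -kE -nE (solid_densityE R hd dE) ler_wpM2r ?exprn_ge0 //.
  exact: solid_density_le.
split=> //; have [Gamma [m [dE km mn]]] := exists_dense_cayley R hd.
have real : realizable d (cayley_order Gamma) by exists Gamma.
exists (cayley_order Gamma); split=> //; apply/eqP; rewrite eq_le lower // andbT.
have [_ /(_ Gamma erefl dE) kle] := kappaP real.
(* It suffices that the root exceeds [kappa + d - 1]. As [kappa + d <= m], this follows from [Delta
   (kappa + d - 1)^d <= Delta (m - 1)^d < n]. *)
rewrite lerBrDr -PoszD -ltzD1 -ltrBlDr ceil_gt_int.
have -> : (kappa d (cayley_order Gamma) + d)%N%:Z - 1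
    = (kappa d (cayley_order Gamma) + d).-1%:Z by lia.
rewrite -pmulrn -(@ltr_pXn2r _ d) ?nnegrE ?powR_ge0 //.
rewrite powR_inv_expr ?divr_ge0 ?(ltW D0) // ltr_pdivlMr // mulrC.
apply: le_lt_trans mn; rewrite ler_wpM2l ?(ltW D0) // lerXn2r ?nnegrE //.
by rewrite ler_nat; lia.
Qed.
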